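(* Every totally positive integer solution $(a_1,\dots,a_n)$ of the equation $R_n(a_1,\dots,a_n)=0$ corresponds to a centrally symmetric triangulation of a $2n$-gon; that is, there is a centrally symmetric triangulation of the (regular) $2n$-gon, with vertices labeled cyclically $1,\dots,2n$, such that for each $1\le i\le n$ the number of triangles adjacent to vertex $i$, and likewise the number of triangles adjacent to vertex $i+n$, equals $a_i$.
   Context: Here $n$ is a positive integer. The continuant $K_m(a_1,\dots,a_m)$ is the determinant of the $m\times m$ tridiagonal matrix with diagonal entries $a_1,\dots,a_m$, all entries immediately above and below the diagonal equal to $1$, and all other entries $0$; by convention $K_0=1$ and $K_{-1}=0$. The rotundus is $R_n(a_1,\dots,a_n):=K_n(a_1,\dots,a_n)-K_{n-2}(a_2,\dots,a_{n-1})$. Given $(a_1,\dots,a_n)$, extend it to an $n$-periodic sequence $(a_i)_{i\in\mathbb{Z}}$. A solution of $R_n(a_1,\dots,a_n)=0$ is called totally positive if $K_{j-i+1}(a_i,a_{i+1},\dots,a_j)>0$ for all integers $i\le j$ with $j-i\le n$. A triangulation of a polygon is a decomposition into triangles by pairwise non-crossing diagonals joining vertices of the polygon. A triangulation of the regular $2n$-gon is centrally symmetric if it is invariant under rotation by $180^\circ$ about the center. A triangle of the triangulation is adjacent to a vertex of the polygon if that vertex is one of its corners. *)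

(* Defs.v *)
From HB Require Import structures.
From mathcomp Require Import all_boot all_order all_algebra.

Set Implicit Arguments.
Unset Strict Implicit.
Unset Printing Implicit Defensive.

Import Order.TTheory GRing.Theory Num.Theory.
Local Open Scope ring_scope.

(* Indices start at 0: (a_1, ..., a_n) is the tuple of entries a_0, ..., a_{n-1}. *)

Definition tridiag (a : int -> int) (i : int) (m : nat) : 'M[int]_m :=
  \matrix_(p < m, q < m)
    if p == q then a (i + p%:Z)
    else if (p == q.+1 :> nat) || (q == p.+1 :> nat) then 1 else 0.

(* K_{j-i+1}(a_i, ..., a_j).  The empty determinant gives K_0 = 1, and the     *)
(* second branch gives K_{-1} = 0; lengths below -1 do not occur in what        *)
(* follows.                                                                     *)
Definition continuant (a : int -> int) (i j : int) : int :=
  match j - i + 1 with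
  | Posz m => \det (tridiag a i m)
  | Negz _ => 0
  end.

Definition periodic_ext (n : nat) (a : n.-tuple int) (i : int) : int :=
  nth 0 a `|(i %% n%:Z)%Z|%N.

Definition rotundus (n : nat) (a : n.-tuple int) : int :=
  continuant (periodic_ext a) 0 (n%:Z - 1)
  - continuant (periodic_ext a) 1 (n%:Z - 2).

Definition totally_positive (n : nat) (a : n.-tuple int) : Prop :=
  forall i j : int, i <= j -> j - i <= n%:Z ->
    0 < continuant (periodic_ext a) i j.

(* The vertices of a convex N-gon are the elements of 'I_N in cyclic order, and *)
(* a side or diagonal is the 2-element set of its end points.                   *)

Definition cyclic_lt (N : nat) (u w v : 'I_N) : bool :=
  [|| (u < w < v)%N, (w < v < u)%N | (v < u < w)%N].

Definition side (N : nat) (e : {set 'I_N}) : bool :=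
  [exists u : 'I_N, e == [set u; ordS u]].

Definition diagonal (N : nat) (e : {set 'I_N}) : bool :=
  (#|e| == 2) && ~~ side e.

(* Two diagonals of a convex polygon meet in its interior iff their end points  *)
(* alternate around the boundary.                                               *)
Definition crossing (N : nat) (e f : {set 'I_N}) : bool :=
  [exists u : 'I_N, exists v : 'I_N, exists w : 'I_N, exists x : 'I_N,
    [&& e == [set u; w], f == [set v; x], cyclic_lt u v w & cyclic_lt w x u]].

Definition consecutive (N : nat) (C : {set 'I_N}) (u v : 'I_N) : bool :=
  [forall w in C, ~~ cyclic_lt u w v] || [forall w in C, ~~ cyclic_lt v w u].

(* A piece into which the diagonals D cut the polygon, given by its corners: it *)
(* is bounded by sides and members of D, and no member of D runs through it.    *)
Definition cell (N : nat) (D : {set {set 'I_N}}) (C : {set 'I_N}) : bool :=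
  (2 < #|C|)%N &&
  [forall u in C, forall v in C, (u != v) ==>
    (consecutive C u v == side [set u; v] || ([set u; v] \in D))].

Definition triangulation (N : nat) (D : {set {set 'I_N}}) : Prop :=
  [/\ forall e, e \in D -> diagonal e,
      forall e f, e \in D -> f \in D -> ~~ crossing e f
    & forall C, cell D C -> #|C| = 3].

Definition triangles_at (N : nat) (D : {set {set 'I_N}}) (v : 'I_N) : nat :=
  #|[set C : {set 'I_N} | cell D C & v \in C]|.

Definition half_turn (n : nat) (v : 'I_(n + n)) : 'I_(n + n) :=
  iter n (@ordS (n + n)) v.

Definition centrally_symmetric (n : nat) (D : {set {set 'I_(n + n)}}) : Prop :=
  [set @half_turn n @: (e : {set 'I_(n + n)}) | e in D] = D.

(* Main.v *)
Require Import Defs.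
From HB Require Import structures.
From mathcomp Require Import all_boot all_order all_algebra.
From mathcomp Require Import zify ring.

Set Implicit Arguments.
Unset Strict Implicit.
Unset Printing Implicit Defensive.

Import Order.TTheory GRing.Theory Num.Theory.
Local Open Scope ring_scope.

(* Let V_0 = (1,0), V_1 = (0,1), V_{k+2} = a_k V_{k+1} - V_k in Z^2, so that    *)
(* K(a_i, ..., a_{j-2}) = det(V_i, V_j).  The monodromy V_k -> V_{k+n} has      *)
(* determinant 1 and trace R_n = 0, hence square -1, so V_{k+2n} = - V_k, and   *)
(* total positivity yields det(V_i, V_j) > 0 for i < j < i + 2n.                *)
(* The triangulation consists of the diagonals {i, j} with |det| = 1.  Two of   *)
(* them cannot cross, as Ptolemy's relation would read 1 = xy + zt with         *)
(* positive integers x, y, z, t.  Writing V_k = y_k V_u - s_k V_c, a            *)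
(* discrete intermediate value argument for the slopes s_k / y_k shows that     *)
(* every integer slope between two vertices joined to c is attained at a vertex *)
(* joined to c.  So the neighbours of c have consecutive integer slopes, and    *)
(* a_c of them are followed by another one, with which they span a triangle.    *)
(* The same fact applied to the first, second and last corner of a cell with    *)
(* more than 3 corners produces a diagonal through that cell.                   *)

(** The argument splits at the record [frieze]. On one side, [det_tridiag_cross] turns continuants
    into determinants of pairs of vectors, and [rotundus_frieze] shows that a totally positive
    solution gives a unimodular, positive, antiperiodic sequence with [N = n + n]. On the other
    side, every such sequence yields a triangulation: [frieze_farey] is the key fact, and
    [cell_card3] and the count [triangles_at_unit_diagonals] rest on it. The half turn is a symmetry
    because it acts by the monodromy, which preserves determinants. *)

Lemma det_tridiag_rec (a : int -> int) (i : int) (m : nat) :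
  \det (tridiag a i m.+2) =
  a i * \det (tridiag a (i + 1) m.+1) - \det (tridiag a (i + 2) m).
Proof.
rewrite (expand_det_row _ ord0) !big_ord_recl big1 => [|k _]; last first.
  by rewrite !mxE /= /bump /= mul0r.
rewrite addr0 !mxE /= mul1r addr0; congr (_ * _ + _).
  rewrite /cofactor expr0 mul1r; congr (\det _).
  apply/matrixP=> r s; rewrite !mxE (inj_eq lift_inj) /= /bump /= ?add1n !eqSS.
  by rewrite -addrA -PoszD add1n.
rewrite /cofactor expr1 mulN1r (expand_det_col _ ord0) big_ord_recl big1 => [|k _]; last first.
  by rewrite !mxE /= /bump /= ?add1n mul0r.
rewrite addr0 !mxE /= mul1r /cofactor expr0 mul1r; congr (- \det _).
apply/matrixP=> r s; rewrite !mxE.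
have -> : lift (lift ord0 ord0) (lift ord0 s) = lift ord0 (lift ord0 s) :> 'I_m.+2.
  by apply/val_inj; rewrite /= /bump /= ??add1n.
rewrite !(inj_eq lift_inj) /= /bump /= ?add1n !eqSS.
by rewrite -addrA -PoszD add2n.
Qed.

(** Initial values [1, 0] and [0, 1] give the two coordinates of [V_k]. *)
Fixpoint recur (a : nat -> int) (s t : int) (k : nat) : int :=
  match k with
  | 0 => s
  | k'.+1 => match k' with
             | 0 => t
             | k''.+1 => a k'' * recur a s t k' - recur a s t k''
             end
  end.

Lemma recurSS a s t k :
  recur a s t k.+2 = a k * recur a s t k.+1 - recur a s t k.
Proof. by []. Qed.

Definition cross (p q : nat -> int) (i j : nat) : int := p i * q j - p j * q i.

Lemma cross_recur_succ a i : cross (recur a 1 0) (recur a 0 1) i i.+1 = 1.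
Proof.
elim: i => [|i IH]; first by rewrite /cross /=; ring.
by rewrite -[RHS]IH /cross !recurSS; ring.
Qed.

(** Both sides obey the same second-order recursion in the left end [i], since
    [V_i = a_i V_{i+1} - V_{i+2}]; hence two consecutive sizes are carried through the induction. *)
Lemma det_tridiag_cross (a : int -> int) (i m : nat) :
  \det (tridiag a i m) =
  cross (recur (a \o Posz) 1 0) (recur (a \o Posz) 0 1) i (i + m.+1).
Proof.
set p := recur _ _ _; set q := recur _ _ _.
suff H : forall m i, \det (tridiag a i%:Z m) = cross p q i (i + m.+1) /\
    \det (tridiag a i%:Z m.+1) = cross p q i (i + m.+2) by case: (H m i).
move=> {m i}; elim=> [|m IH] i.
  rewrite det_mx00 addn1 cross_recur_succ addn2; split=> //.
  have := cross_recur_succ (a \o Posz) i.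
  rewrite -/p -/q /cross det_mx11 !mxE /= /p /q !recurSS /= addr0 => H.
  by rewrite -[LHS]mulr1 -[X in _ * X]H; ring.
case: (IH i) => _ H1; split=> //; rewrite det_tridiag_rec.
have [_] := IH i.+1; have [] := IH i.+2 => + _.
have -> : i.+1%:Z = i%:Z + 1 by lia.
have -> : i.+2%:Z = i%:Z + 2 by lia.
move=> -> ->; rewrite !addSn -!addnS.
by rewrite /cross /p /q !(recurSS _ _ _ i) /=; ring.
Qed.

(** By periodicity both sides solve the recurrence in [k], and they agree at [0] and [1]. Applied to
    both coordinates, this is the monodromy matrix with columns [V_n] and [V_{n+1}]. *)
Lemma recur_shift a s t n k :
    (forall i, a (i + n)%N = a i) ->
  recur a s t (k + n) =
  recur a 1 0 k * recur a s t n + recur a 0 1 k * recur a s t n.+1.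
Proof.
move=> a_per.
pose P k := recur a s t (k + n) =
  recur a 1 0 k * recur a s t n + recur a 0 1 k * recur a s t n.+1.
suff [] : P k /\ P k.+1 by [].
rewrite {}/P; elim: k => [|k [IH1 IH2]]; first by rewrite /= !(mul1r, mul0r, addr0, add0r).
split=> //; rewrite !addSn !recurSS -addSn IH2 IH1 a_per.
by ring.
Qed.

(** * Friezes and the cyclic order *)

(** The numbers [cross p q i j] form a Conway-Coxeter frieze pattern; the geometric half of the
    proof uses only these three properties. *)
Record frieze (N : nat) (p q : nat -> int) : Prop := Frieze {
  frieze_succ : forall i, cross p q i i.+1 = 1;
  frieze_gt0 : forall i j, (i < j < i + N)%N -> 0 < cross p q i j;
  frieze_antiper : forall i, p (i + N)%N = - p i /\ q (i + N)%N = - q i }.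

Lemma ptolemy p q i j k l :
  cross p q i k * cross p q j l =
  cross p q i j * cross p q k l + cross p q i l * cross p q j k.
Proof. by rewrite /cross; ring. Qed.

Lemma crossC p q i j : cross p q j i = - cross p q i j.
Proof. by rewrite /cross; ring. Qed.

Lemma eqn_mod_near (N i j : nat) :
  (i <= j < i + N)%N -> i = j %[mod N] -> i = j.
Proof.
move=> /andP[ij jN] /eqP; rewrite eq_sym eqn_mod_dvd // => Nij.
by have [?|/dvdn_leq/(_ Nij)] := posnP (j - i); lia.
Qed.

Lemma cyclic_lt_between (N : nat) (u w v : 'I_N) :
  (u < v)%N -> cyclic_lt u w v = (u < w < v)%N.
Proof. by rewrite /cyclic_lt => uv; lia. Qed.

Lemma cyclic_lt_outside (N : nat) (u w v : 'I_N) :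
  (u < v)%N -> cyclic_lt v w u = (w < u)%N || (v < w)%N.
Proof. by rewrite /cyclic_lt => uv; lia. Qed.

(** Otherwise both open arcs between [u] and [v] contain a corner, which makes four. *)
Lemma consecutive_card3 (N : nat) (C : {set 'I_N}) (u v : 'I_N) :
  #|C| = 3 -> u \in C -> v \in C -> u != v -> consecutive C u v.
Proof.
move=> C3 uC vC uv; apply/norP=> -[].
move=> /forall_inPn/= [w wC /negbNE uwv] /forall_inPn/= [z zC /negbNE vzu].
have: uniq [:: u; v; w; z].
  rewrite /= !inE -!val_eqE /=; move: uv uwv vzu; rewrite /cyclic_lt -val_eqE /=; lia.
move=> s_uniq; have := @uniq_leq_size _ _ (enum C) s_uniq.
rewrite /= -cardE C3 => H.
suff: {subset [:: u; v; w; z] <= enum C} by move/H.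
by move=> y; rewrite mem_enum !inE => /or4P[] /eqP->.
Qed.

(** The absolute value makes the condition independent of the order of the end points and, under
    antiperiodicity, of representatives modulo [N]. *)
Definition unit_diagonals (N : nat) (p q : nat -> int) : {set {set 'I_N}} :=
  [set e | diagonal e &&
    [exists u : 'I_N, exists v : 'I_N,
      (e == [set u; v]) && (`|cross p q u v| == 1)]].

(** * The triangulation attached to a frieze *)

Section Frieze.
Variables (N : nat) (p q : nat -> int).
Hypothesis F : frieze N p q.
Let x := cross p q.
Let xS : forall i, x i i.+1 = 1 := frieze_succ F.

Lemma frieze_crossing i j k l :
  (i < j)%N -> (j < k)%N -> (k < l)%N -> (l < i + N)%N -> x i k = 1 -> x j l = 1 -> False.
Proof.
move=> ij jk kl lN xik xjl; have := ptolemy p q i j k l.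
rewrite -/x xik xjl.
have := @frieze_gt0 _ _ _ F i j; have := @frieze_gt0 _ _ _ F i l.
have := @frieze_gt0 _ _ _ F j k; have := @frieze_gt0 _ _ _ F k l.
rewrite -/x; nia.
Qed.

(** Consecutive slopes [x u k / x c k] are Farey neighbours, and no integer lies strictly between
    two of those. So the first slope that reaches [t] equals [t], and its denominator is [1]. *)
Lemma frieze_farey c u w (t : int) :
  (c < u)%N -> (u <= w)%N -> (w < c + N)%N -> x c u = 1 -> x c w = 1 ->
  0 <= t <= x u w -> exists k, [/\ (u <= k <= w)%N, x c k = 1 & x u k = t].
Proof.
move=> cu uw wN xcu xcw t_bd.
(* [s k] is the determinant of [V_u - t V_c] and [V_k]. *)
pose s k := x u k - t * x c k.
have pluecker i j : s i * x c j - s j * x c i = - x i j.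
  have E : x u i * x c j - x u j * x c i = - x i j.
    by rewrite -[RHS]mulr1 -xcu /x /cross; ring.
  by rewrite -E /s; ring.
have s_ge0 : 0 <= s w by rewrite /s xcw mulr1; lia.
have s_le0 : s u <= 0 by rewrite /s xcu /x /cross; lia.
have ypos k : (u <= k <= w)%N -> 0 < x c k.
  by move=> uk; apply: (frieze_gt0 F); lia.
have exk : exists k, (u <= k)%N && (0 <= s k) by exists w; lia.
have [k /andP[uk sk] kmin] := ex_minnP exk.
have kw : (k <= w)%N by apply: kmin; rewrite uw.
have yk : 0 < x c k by apply: ypos; lia.
have [sk0|sk0] := eqVneq (s k) 0.
  exists k; have := pluecker k k.+1; rewrite sk0 mul0r sub0r.
  rewrite xS => /oppr_inj yk1.
  have xck : x c k = 1.
    move: yk yk1; generalize (x c k) (s k.+1) => y z y_gt0 zy.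
    by have [?|?] := lerP z 0; nia.
  by split; [lia | | move: sk0; rewrite /s xck; lia].
(* Otherwise [s] jumps from negative to positive in one step, and [pluecker] would write [1] as a
   sum of two positive integers. *)
have uk' : (u < k)%N by rewrite ltn_neqAle uk andbT; apply/eqP=> E; subst k; lia.
case: k => // k in uk sk kmin kw yk sk0 uk' *.
have ltsk : s k < 0.
  by rewrite ltNge; apply/negP=> H; have := kmin k; lia.
have := pluecker k k.+1; rewrite xS.
have : 0 < x c k by apply: ypos; lia.
nia.
Qed.

Let D := unit_diagonals N p q.

Lemma cross_addN i j : x i (j + N) = - x i j.
Proof. by have [pE qE] := frieze_antiper F j; rewrite /x /cross pE qE; ring. Qed.

Lemma cross_ord_gt0 (u v : 'I_N) : (u < v)%N -> 0 < x u v.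
Proof. by move=> uv; apply: (frieze_gt0 F); have := ltn_ord v; lia. Qed.

Lemma normr_cross_mod i j : `|x i (j %% N)%N| = `|x i j|.
Proof.
rewrite [in RHS](divn_eq j N); elim: (j %/ N)%N => [|m IH]; first by rewrite mul0n.
by rewrite mulSn -addnA addnC cross_addN normrN.
Qed.

Lemma normr_crossC i j : `|x i j| = `|x j i|.
Proof. by rewrite /x crossC normrN. Qed.

(** Sides have determinant [1] up to sign as well, so cells can be recognised by determinants
    alone. *)
Lemma side_or_unit_diagonal (u v : 'I_N) :
  u != v -> side [set u; v] || ([set u; v] \in D) = (`|x u v| == 1).
Proof.
have set2E (a b c d : 'I_N) : [set a; b] = [set c; d] -> `|x a b| = `|x c d|.
  move=> E; have : c \in [set a; b] by rewrite E !inE eqxx.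
  have : d \in [set a; b] by rewrite E !inE eqxx orbT.
  have : a \in [set c; d] by rewrite -E !inE eqxx.
  have : b \in [set c; d] by rewrite -E !inE eqxx orbT.
  rewrite !inE.
  by do 4![case/orP=> /eqP ?]; subst=> //; rewrite normr_crossC.
move=> uv; apply/orP/idP.
  case=> [/existsP[w /eqP E]|].
    by rewrite (set2E _ _ _ _ E) /= normr_cross_mod xS.
  rewrite inE => /andP[_ /existsP[w /existsP[z /andP[/eqP E]]]].
  by rewrite (set2E _ _ _ _ E).
move=> uv1; have [?|nside] := boolP (side [set u; v]); [by left|right].
rewrite inE /diagonal cards2 uv nside /=.
by apply/existsP; exists u; apply/existsP; exists v; rewrite eqxx.
Qed.

Lemma cell_unit_diagonalsP (C : {set 'I_N}) :
  reflect ((2 < #|C|)%N /\ forall u v, u \in C -> v \in C -> u != v ->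
             consecutive C u v = (`|x u v| == 1))
          (cell D C).
Proof.
apply: (iffP andP) => -[C2 H]; split=> //.
  move=> u v uC vC uv; move/forall_inP: H => /(_ _ uC)/forall_inP/(_ _ vC).
  by rewrite uv /= side_or_unit_diagonal // => /eqP.
apply/forall_inP=> u uC; apply/forall_inP=> v vC; apply/implyP=> uv.
by rewrite side_or_unit_diagonal // H.
Qed.

Lemma cell3P (C : {set 'I_N}) : #|C| = 3 ->
  reflect (forall u v, u \in C -> v \in C -> u != v -> `|x u v| = 1) (cell D C).
Proof.
move=> C3; apply: (iffP (cell_unit_diagonalsP C)) => [[_ H] u v uC vC uv|H].
  by apply/eqP; rewrite -H // consecutive_card3.
rewrite C3; split=> // u v uC vC uv.
by rewrite H // eqxx consecutive_card3.
Qed.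

Lemma ord_crossing (i j k l : 'I_N) :
  (i < j < k)%N -> (k < l)%N -> `|x i k| = 1 -> `|x j l| = 1 -> False.
Proof.
move=> /andP[ij jk] kl.
have ik := ltn_trans ij jk; have jl := ltn_trans jk kl.
rewrite !gtr0_norm ?cross_ord_gt0 //.
by apply: (frieze_crossing ij jk kl); have := ltn_ord l; lia.
Qed.

Lemma unit_diagonals_noncrossing e f : e \in D -> f \in D -> ~~ crossing e f.
Proof.
move=> eD fD; apply/negP.
move=> /existsP[u /existsP[v /existsP[w /existsP[z /and4P[/eqP eE /eqP fE uvw wzu]]]]].
have uw : `|x u w| = 1.
  by apply/eqP; rewrite -side_or_unit_diagonal -?eE ?eD ?orbT // -val_eqE /=;
     move: uvw; rewrite /cyclic_lt; lia.
have vz : `|x v z| = 1.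
  by apply/eqP; rewrite -side_or_unit_diagonal -?fE ?fD ?orbT // -val_eqE /=;
     move: uvw wzu; rewrite /cyclic_lt; lia.
have wu : `|x w u| = 1 by rewrite normr_crossC.
have zv : `|x z v| = 1 by rewrite normr_crossC.
move: uvw wzu; rewrite /cyclic_lt => H1 H2.
(* The alternating end points are increasing after one of four rotations. *)
have [?|?] := boolP ((u < v < w) && (w < z))%N; first by apply: (@ord_crossing u v w z); lia.
have [?|?] := boolP ((v < w < z) && (z < u))%N; first by apply: (@ord_crossing v w z u); lia.
have [?|?] := boolP ((w < z < u) && (u < v))%N; first by apply: (@ord_crossing w z u v); lia.
have [?|?] := boolP ((z < u < v) && (v < w))%N; first by apply: (@ord_crossing z u v w); lia.
lia.
Qed.

Lemma cell_card3 (C : {set 'I_N}) : cell D C -> #|C| = 3.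
Proof.
move=> /cell_unit_diagonalsP[C2 Ccons].
have consE u v : u \in C -> v \in C -> (u < v)%N -> consecutive C u v = (x u v == 1).
  move=> uC vC uv; rewrite Ccons // ?gtr0_norm ?cross_ord_gt0 //.
  by rewrite -val_eqE /=; lia.
have [c0 c0C] : exists c, c \in C by apply/card_gt0P; lia.
have [c cC cmin] := @arg_minnP _ _ (fun z => z \in C) (@nat_of_ord N) c0C.
have cltz z : z \in C :\ c -> (c < z)%N.
  by move=> /setD1P[zc zC]; have := cmin _ zC; move: zc; rewrite -val_eqE /=; lia.
have Cc2 : (1 < #|C :\ c|)%N by move: C2; rewrite (cardsD1 c C) cC.
have [u0 u0C] : exists u, u \in C :\ c by apply/card_gt0P; lia.
have [u uC umin] := @arg_minnP _ _ (fun z => z \in C :\ c) (@nat_of_ord N) u0C.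
have [w wC wmax] := @arg_maxnP _ _ (fun z => z \in C :\ c) (@nat_of_ord N) u0C.
have cu := cltz _ uC; have cw := cltz _ wC.
have CP z : z \in C -> z = c \/ (u <= z <= w)%N.
  have [->|zc] := eqVneq z c; first by left.
  move=> zC; have z' : z \in C :\ c by rewrite !inE zc.
  right; apply/andP; split; [exact: umin | exact: wmax].
have uw : (u < w)%N.
  rewrite ltnNge; apply/negP=> wu; move: Cc2.
  rewrite (_ : C :\ c = [set u]) ?cards1 //; apply/setP=> z; rewrite [RHS]inE.
  apply/idP/eqP=> [zC|->//]; apply/val_inj/eqP; rewrite /= eqn_leq.
  by have := umin z zC; have := wmax z zC; lia.
have [[_ uC'] [_ wC']] := (setD1P uC, setD1P wC).
have xcu : x c u = 1.
  apply/eqP; rewrite -consE //; apply/orP; left; apply/forall_inP=> z zC.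
  rewrite cyclic_lt_between // negb_and.
  by case: (CP z zC) => [->|/andP[uz _]]; rewrite -!leqNgt ?leqnn ?uz ?orbT.
have xcw : x c w = 1.
  apply/eqP; rewrite -consE //; apply/orP; right; apply/forall_inP=> z zC.
  rewrite cyclic_lt_outside // negb_or -!leqNgt (cmin _ zC) /=.
  by case: (CP z zC) => [->|/andP[]//]; exact: ltnW.
have [xuw|xuw] := eqVneq (x u w) 1.
  (* If the arc from [u] to [w] is empty, only three corners remain; the other arc contains [c]. *)
  have /orP[] : consecutive C u w by rewrite consE // xuw.
    move=> /forall_inP H.
    have -> : C = [set c; u; w].
      apply/setP=> z; rewrite !inE; apply/idP/idP=> [zC|].
        have := H _ zC; rewrite cyclic_lt_between // negb_and -!leqNgt -!val_eqE /=.
        by case: (CP z zC) => [->|]; clear; lia.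
      by case/orP=> [/orP[]|] /eqP->.
    have [/negbTE uc /negbTE wc] : u != c /\ w != c.
      by rewrite -!val_eqE /= !gtn_eqF.
    rewrite -setUA cardsU1 cards2 !inE (eq_sym c u) (eq_sym c w) uc wc /=.
    by rewrite -val_eqE /= ltn_eqF.
  by move=> /forall_inP/(_ _ cC); rewrite cyclic_lt_outside // cu.
(* Slope [1] is attained at some [k] joined to [c], and strictly between [u] and [w], whose slopes
   are [0] and at least [2]. *)
have xuw2 : 0 <= (1 : int) <= x u w by have := cross_ord_gt0 uw; lia.
have wN : (w < c + N)%N by have := ltn_ord w; lia.
have [k [ukw xck xuk]] := frieze_farey cu (ltnW uw) wN xcu xcw xuw2.
have kN : (k < N)%N by have := ltn_ord w; lia.
pose k' := Ordinal kN.
case/andP: ukw; rewrite leq_eqVlt => /predU1P[E|uk].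
  by move: xuk; rewrite -E /x /cross subrr.
rewrite leq_eqVlt => /predU1P[E|kw]; first by move: xuw; rewrite -E xuk eqxx.
have ck := ltn_trans cu uk.
exfalso; have [kC|kC] := boolP (k' \in C).
  have /orP[] : consecutive C c k' by rewrite consE //= xck.
    by move=> /forall_inP/(_ _ uC'); rewrite cyclic_lt_between //= cu uk.
  by move=> /forall_inP/(_ _ wC'); rewrite cyclic_lt_outside //= kw orbT.
(* If [k] is not a corner, the nearest corners [e] and [f] on its two sides are consecutive, so
   [e f] has determinant [1] and crosses [c k]. *)
have uP : (u \in C) && (u < k)%N by rewrite uC'.
have wP : (w \in C) && (k < w)%N by rewrite wC'.
have [e /andP[eC ek] emax] :=
  @arg_maxnP _ u (fun z : 'I_N => (z \in C) && (z < k)%N) (@nat_of_ord N) uP.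
have [f /andP[fC kf] fmin] :=
  @arg_minnP _ w (fun z : 'I_N => (z \in C) && (k < z)%N) (@nat_of_ord N) wP.
have ce : (c < e)%N := leq_trans cu (emax u uP).
have xef : x e f = 1.
  apply/eqP; rewrite -consE //; last exact: ltn_trans kf.
  apply/orP; left; apply/forall_inP=> z zC.
  have /negbTE zk : z != k :> nat.
    by apply/eqP=> E; move: kC; rewrite (_ : k' = z) ?zC //; apply/val_inj.
  rewrite (cyclic_lt_between _ (ltn_trans ek kf)).
  have := emax z; have := fmin z; rewrite zC; case: ltngtP zk => //= zk _.
    by move=> /(_ isT) fz _; rewrite [(z < f)%N]ltnNge fz andbF.
  by move=> _ /(_ isT) ze; rewrite ltnNge ze.
have xck1 : `|x c k'| = 1 by rewrite /= xck.
by apply: (@ord_crossing c e k' f _ _ xck1); rewrite ?xef //= ce.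
Qed.

Lemma unit_diagonals_triangulation : triangulation D.
Proof.
split=> [e||]; [by rewrite inE => /andP[]| exact: unit_diagonals_noncrossing | exact: cell_card3].
Qed.

(** * Counting the triangles at a vertex *)

(** Seen from [v], the vertices joined to it have slopes [0, ..., x a b], each attained once; the
    triangles at [v] are spanned by pairs of successive slopes. *)
Lemma triangles_at_unit_diagonals (v : 'I_N) :
  (1 < N)%N -> (triangles_at D v)%:Z = x v.+1 (v + N.-1).
Proof.
move=> N1; pose a := v.+1; pose b := (v + N.-1)%N.
have vN := ltn_ord v; have N_gt0 : (0 < N)%N by lia.
have xva : x v a = 1 by exact: xS.
have xvb : x v b = 1.
  rewrite -(xS (v + N.-1)); have -> : (v + N.-1).+1 = (v + N)%N by lia.
  by rewrite cross_addN; exact: crossC.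
have ab : (a <= b)%N by rewrite /a /b; lia.
have bN : (b < v + N)%N by rewrite /b; lia.
have x_ge0 i j : (a <= i <= j)%N -> (j <= b)%N -> 0 <= x i j.
  move=> /andP[ai ij] jb; have [->|ij'] := eqVneq i j; first by rewrite /x /cross subrr.
  by apply/ltW/(frieze_gt0 F); lia.
have x0 i j : (a <= i <= b)%N -> (a <= j <= b)%N -> x i j = 0 -> i = j.
  move=> i_bd j_bd xij; apply/eqP; case: ltngtP => // ij.
    by have := @frieze_gt0 _ _ _ F i j; rewrite -/x xij; lia.
  by have := @frieze_gt0 _ _ _ F j i; rewrite crossC -/x xij; lia.
(* For vertices joined to [v], the determinant is the difference of slopes. *)
have xE i j : x v i = 1 -> x v j = 1 -> x i j = x a j - x a i.
  move=> vi vj; have := ptolemy p q v a i j.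
  rewrite -/x vi vj xva !mul1r => ->; ring.
have Z_ge0 : 0 <= x a b by apply: x_ge0; lia.
pose P (t k : nat) := [&& (a <= k <= b)%N, x v k == 1 & x a k == t].
(* The implication makes [k] total; its values at slopes beyond [x a b] are arbitrary. *)
have exP (t : nat) : exists k, (t%:Z <= x a b) ==> P t k.
  have [t_bd|_] := boolP (t%:Z <= x a b); last by exists 0%N.
  have t_bd' : 0 <= t%:Z <= x a b by lia.
  have [k [H1 H2 H3]] := frieze_farey (ltnSn v) ab bN xva xvb t_bd'.
  by exists k; rewrite /P H1 H2 H3 !eqxx.
pose k t := xchoose (exP t).
have kP (t : nat) : t%:Z <= x a b -> [/\ (a <= k t <= b)%N, x v (k t) = 1 & x a (k t) = t].
  move=> t_bd; have /implyP/(_ t_bd)/and3P[k_bd /eqP xvk /eqP xak] := xchooseP (exP t).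
  by split.
(* Reduction modulo [N] maps the indices from [a] to [b] bijectively onto the vertices other than
   [v]. *)
pose vert i : 'I_N := Ordinal (ltn_pmod i N_gt0).
have vertN i : `|x v (vert i)| = `|x v i| by rewrite normr_cross_mod.
have vertE i j : `|x (vert i) (vert j)| = `|x i j|.
  by rewrite normr_cross_mod normr_crossC normr_cross_mod normr_crossC.
have vertK (u : 'I_N) : u != v -> exists2 i, (a <= i <= b)%N & vert i = u.
  rewrite -val_eqE /= => uv; have uN := ltn_ord u.
  have [vu|vu] := ltnP v u.
    by exists (u : nat); [rewrite /a /b; lia | apply/val_inj; rewrite /= modn_small].
  exists (u + N)%N; first by rewrite /a /b; lia.
  by apply/val_inj; rewrite /= modnDr modn_small.
have vert_inj i j : (a <= i <= b)%N -> (a <= j <= b)%N -> vert i = vert j -> i = j.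
  rewrite /a /b => i_bd j_bd /(congr1 val)/= E.
  have [ij|ji] := leqP i j; first by apply: eqn_mod_near E; clear -ij i_bd j_bd; lia.
  by apply/esym; apply: eqn_mod_near (esym E); clear -ji i_bd j_bd; lia.
have vert_neq i : (a <= i <= b)%N -> vert i != v.
  rewrite /a /b => i_bd; rewrite -val_eqE /=; apply/eqP=> E.
  have vi : v = i %[mod N] by rewrite E modn_small.
  suff : v = i :> nat by clear -i_bd; lia.
  by apply: eqn_mod_near vi; clear -i_bd N_gt0; lia.
pose f (t : 'I_`|x a b|%N) := [set v; vert (k t); vert (k t.+1)].
have tP (t : 'I_`|x a b|%N) : t.+1%:Z <= x a b by have := ltn_ord t; lia.
have tP' (t : 'I_`|x a b|%N) : t%:Z <= x a b by have := tP t; lia.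
have kE (s t : nat) : s%:Z <= x a b -> t%:Z <= x a b -> (vert (k s) == vert (k t)) = (s == t).
  move=> /kP[s1 _ s3] /kP[t1 _ t3]; apply/eqP/eqP=> [/vert_inj E|->//].
  by move: s3; rewrite E // t3 => -[].
have kv (t : nat) : t%:Z <= x a b -> (vert (k t) == v) = false.
  by move=> /kP[t1 _ _]; apply/negbTE/vert_neq.
have f_inj : injective f.
  move=> s t E; apply/val_inj => /=.
  have : vert (k s) \in f t by rewrite -E !inE eqxx !orbT.
  have : vert (k s.+1) \in f t by rewrite -E !inE eqxx !orbT.
  rewrite !inE !kv // !kE //; clear; lia.
rewrite /triangles_at -/b -/a.
suff -> : [set C | cell D C & v \in C] = f @: setT.
  by rewrite card_imset // cardsT card_ord; lia.
apply/setP=> C; rewrite inE; apply/andP/imsetP.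
  move=> [Ccell vC]; have C3 := cell_card3 Ccell.
  have /cards2P[y [z [yz Cv]]] : #|C :\ v| == 2.
    by move: C3; rewrite (cardsD1 v C) vC add1n => -[->].
  have CE : C = [set v; y; z] by rewrite -setUA -Cv setD1K.
  have : y \in C :\ v by rewrite Cv !inE eqxx.
  have : z \in C :\ v by rewrite Cv !inE eqxx orbT.
  move=> /setD1P[zv zC] /setD1P[yv yC].
  have [i i_bd iy] := vertK _ yv; have [j j_bd jz] := vertK _ zv.
  have W := cell3P C3 Ccell; clear Cv.
  wlog ij : i j y z yz CE zv zC yv yC i_bd iy j_bd jz / (i < j)%N.
    move=> H; have [ij|ij|ij] := ltngtP i j; first exact: (H i j y z).
      by apply: (H j i z y) => //; [rewrite eq_sym | rewrite CE -!setUA (setUC [set y])].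
    by move: yz; rewrite -iy -jz ij eqxx.
  have xvi : x v i = 1.
    have := W _ _ vC yC; rewrite -iy vertN eq_sym iy yv gtr0_norm; first by apply.
    by apply: (frieze_gt0 F); rewrite /a /b in i_bd; lia.
  have xvj : x v j = 1.
    have := W _ _ vC zC; rewrite -jz vertN eq_sym jz zv gtr0_norm; first by apply.
    by apply: (frieze_gt0 F); rewrite /a /b in j_bd; lia.
  have xij : x i j = 1.
    have := W _ _ yC zC yz; rewrite -iy -jz vertE gtr0_norm //.
    by apply: (frieze_gt0 F); rewrite /a /b in i_bd j_bd; lia.
  have xai : 0 <= x a i by apply: x_ge0; lia.
  have xjb : 0 <= x j b by apply: x_ge0; lia.
  have E1 := xE _ _ xvi xvj; have E2 := xE _ _ xvj xvb.
  have t_bd : (`|x a i| < `|x a b|)%N by lia.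
  exists (Ordinal t_bd) => //; rewrite CE /f /= -iy -jz.
  have [k1 k2 k3] := kP _ (tP' (Ordinal t_bd)).
  have [l1 l2 l3] := kP _ (tP (Ordinal t_bd)).
  have -> : k `|x a i|%N = i by apply: x0 => //; rewrite xE // k3 /=; lia.
  by have -> : k `|x a i|.+1 = j by apply: x0 => //; rewrite xE // l3 /=; lia.
move=> [t _ ->]; split; last by rewrite !inE eqxx.
have [k1 k2 k3] := kP _ (tP' t); have [l1 l2 l3] := kP _ (tP t).
have kl : vert (k t) != vert (k t.+1) by rewrite kE // neq_ltn ltnSn.
have vk : v != vert (k t) by rewrite eq_sym kv.
have vl : v != vert (k t.+1) by rewrite eq_sym kv.
have xkl : `|x (vert (k t)) (vert (k t.+1))| = 1.
  by rewrite vertE xE // k3 l3; lia.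
have xvk : `|x v (vert (k t))| = 1 by rewrite vertN k2.
have xvl : `|x v (vert (k t.+1))| = 1 by rewrite vertN l2.
apply/cell3P; first by rewrite /f -setUA cardsU1 cards2 !inE kl negb_or vk vl.
move=> y z; rewrite !inE -!orbA.
by case/or3P=> /eqP-> /or3P[] /eqP->; rewrite ?eqxx // ?xvk ?xvl ?xkl //;
   rewrite normr_crossC ?xvk ?xvl ?xkl.
Qed.

End Frieze.

(** * The frieze of a totally positive solution *)

Lemma continuant_cross (a : int -> int) (i m : nat) :
  continuant a i (i%:Z + m%:Z - 1) =
  cross (recur (a \o Posz) 1 0) (recur (a \o Posz) 0 1) i (i + m.+1).
Proof.
rewrite -det_tridiag_cross /continuant.
by have -> : i%:Z + m%:Z - 1 - i%:Z + 1 = m by lia.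
Qed.

Lemma half_turnE (n : nat) (v : 'I_(n + n)) : half_turn v = ((v + n) %% (n + n))%N :> nat.
Proof.
suff iterE k : iter k (@ordS (n + n)) v = ((v + k) %% (n + n))%N :> nat by exact: iterE.
elim: k => [|k IH] /=; first by rewrite addn0 modn_small.
by rewrite IH -addn1 modnDml addn1 addnS.
Qed.

Section Rotundus.
Variables (n : nat) (a : n.-tuple int).
Hypotheses (n_gt0 : (0 < n)%N) (ha : rotundus a = 0) (hpos : totally_positive a).
Let A i := periodic_ext a (Posz i).
Let p := recur A 1 0.
Let q := recur A 0 1.

Lemma periodic_ext_add i : A (i + n) = A i.
Proof. by rewrite /A /periodic_ext PoszD modzDr. Qed.

Lemma periodic_ext_ord (i : 'I_n) : A i = tnth a i.
Proof.
by rewrite /A /periodic_ext modz_small ?absz_nat ?ltz_nat ?ltn_ord // -tnth_nth.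
Qed.

(** As [V_0 = (1,0)] and [V_1 = (0,1)], the two continuants in the rotundus are [q n.+1] and
    [- p n], so it is the trace of the monodromy. *)
Lemma rotundus_trace : p n + q n.+1 = 0.
Proof.
move: ha; rewrite /rotundus.
have := continuant_cross (periodic_ext a) 0 n; rewrite add0r => ->.
suff inner k : (0 < k)%N -> continuant (periodic_ext a) 1 (k%:Z - 2) = - p k.
  by rewrite inner // opprK /cross -/p -/q mul1r mulr0 subr0 addrC => ->.
(* For [k = 1] both sides vanish: [K_{-1} = 0] and [p 1 = 0]. *)
case: k => [//|[//|m]] _.
have := continuant_cross (periodic_ext a) 1 m.
have -> : 1%:Z + m%:Z - 1 = m.+2%:Z - 2 by lia.
by move=> ->; rewrite /cross add1n mul0r sub0r mulr1.
Qed.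

Lemma rotundus_half k :
  (p (k + n) = p n * p k + p n.+1 * q k) /\ (q (k + n) = q n * p k + q n.+1 * q k).
Proof. by split; rewrite /p /q (recur_shift _ _ _ periodic_ext_add) -/p -/q; ring. Qed.

Lemma rotundus_cross_half i j : cross p q (i + n) (j + n) = cross p q i j.
Proof.
have [pi qi] := rotundus_half i; have [pj qj] := rotundus_half j.
rewrite /cross pi qi pj qj.
have := cross_recur_succ A n; rewrite -/p -/q /cross => E.
rewrite -[RHS]mul1r -E; ring.
Qed.

(** Cayley-Hamilton: the monodromy has trace [0] and determinant [1], so its square is [-1]. *)
Lemma rotundus_antiper i : p (i + (n + n)) = - p i /\ q (i + (n + n)) = - q i.
Proof.
have [pE qE] := rotundus_half (i + n); have [pE' qE'] := rotundus_half i.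
rewrite addnA pE qE pE' qE'.
have := cross_recur_succ A n; rewrite -/p -/q /cross.
have -> : q n.+1 = - p n by apply/eqP; rewrite -addr_eq0 addrC rotundus_trace.
move=> E; rewrite -[- p i]mulr1 -[- q i]mulr1 -{}E.
by split; ring.
Qed.

(** Total positivity covers index gaps up to [n + 2]. A gap above [n] is replaced by its complement
    in [n + n], since antiperiodicity gives [det(V_i, V_j) = det(V_j, V_{i+2n})]. *)
Lemma rotundus_cross_gt0 i j : (i < j < i + (n + n))%N -> 0 < cross p q i j.
Proof.
have small k m : (0 < m <= n.+2)%N -> 0 < cross p q k (k + m).
  case: m => [//|[|m]] m_bd; first by rewrite addn1 cross_recur_succ.
  rewrite -(continuant_cross (periodic_ext a) k m.+1).
  by apply: hpos; lia.
move=> ij; have [jn|jn] := leqP j (i + n).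
  have -> : j = (i + (j - i))%N by lia.
  by apply: small; lia.
have := small j (i + (n + n) - j)%N.
have -> : (j + (i + (n + n) - j) = i + (n + n))%N by lia.
rewrite {1}/cross (rotundus_antiper i).1 (rotundus_antiper i).2.
have -> : p j * - q i - - p i * q j = cross p q i j by rewrite /cross; ring.
by apply; lia.
Qed.

Lemma rotundus_frieze : frieze (n + n) (fun k => p k.+1) (fun k => q k.+1).
Proof.
split=> [i|i j ij|i].
- exact: (cross_recur_succ A i.+1).
- by apply: (@rotundus_cross_gt0 i.+1 j.+1); lia.
- exact: (rotundus_antiper i.+1).
Qed.

(* The shift by one makes vertex i carry V_{i+1}, whose two neighbours sum to *)
(* a_i V_{i+1}. *)
Let F := rotundus_frieze.
Let D := unit_diagonals (n + n) (fun k => p k.+1) (fun k => q k.+1).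

(** The neighbours of [V_{v+1}] are [V_{v+2}] and [V_{v+2n} = - V_v], and their determinant is
    [det(V_v, V_{v+2}) = a_v]. *)
Lemma rotundus_quiddity (v : 'I_(n + n)) : (triangles_at D v)%:Z = A v.
Proof.
rewrite (triangles_at_unit_diagonals F) ?addn_gt0 ?n_gt0 //; last by lia.
have E : (v + (n + n).-1).+1 = (v + (n + n))%N by lia.
rewrite /cross E (rotundus_antiper v).1 (rotundus_antiper v).2.
have := cross_recur_succ A v; rewrite -/p -/q /cross /p /q !recurSS -/p -/q => H.
by rewrite -[RHS]mulr1 -H; ring.
Qed.

Lemma rotundus_normr_half (u v : 'I_(n + n)) :
  `|cross (fun k => p k.+1) (fun k => q k.+1) (half_turn u) (half_turn v)| =
  `|cross (fun k => p k.+1) (fun k => q k.+1) u v|.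
Proof.
rewrite !half_turnE (normr_cross_mod F) (normr_crossC _ _ _ (v + n)) //.
rewrite (normr_cross_mod F) (normr_crossC _ _ _ (u + n)) //.
by congr `|_|; exact: (rotundus_cross_half u.+1 v.+1).
Qed.

Lemma half_turnK : involutive (@half_turn n).
Proof.
move=> v; apply/val_inj; rewrite /= !half_turnE modnDml -addnA modnDr.
by rewrite modn_small.
Qed.

Lemma half_turnS (v : 'I_(n + n)) : half_turn (ordS v) = ordS (half_turn v).
Proof. by rewrite /half_turn -iterSr. Qed.

Lemma half_turn_unit_diagonals e : e \in D -> [set half_turn u | u in e] \in D.
Proof.
have tinj := inv_inj half_turnK.
rewrite !inE => /andP[/andP[/eqP e2 nside] /existsP[u /existsP[v /andP[/eqP eE uv]]]].
apply/andP; split; last first.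
  apply/existsP; exists (half_turn u); apply/existsP; exists (half_turn v).
  by rewrite rotundus_normr_half uv eE imsetU1 imset_set1 eqxx.
rewrite /diagonal card_imset // e2 eqxx /=; apply: contra nside.
move=> /existsP[w /eqP E]; apply/existsP; exists (half_turn w).
have -> : [set half_turn w; ordS (half_turn w)] = [set half_turn u | u in [set w; ordS w]].
  by rewrite imsetU1 imset_set1 half_turnS.
rewrite -E -imset_comp.
by rewrite (eq_imset _ (g := id)) ?imset_id // => z; rewrite /= half_turnK.
Qed.

Lemma rotundus_symmetric : centrally_symmetric D.
Proof.
apply/setP=> e; apply/imsetP/idP=> [[f fD ->]|eD]; first exact: half_turn_unit_diagonals.
exists [set half_turn u | u in e]; first exact: half_turn_unit_diagonals.
rewrite -imset_comp (eq_imset _ (g := id)) ?imset_id // => z.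
by rewrite /= half_turnK.
Qed.

End Rotundus.

Theorem theorem2 (n : nat) (hn : (0 < n)%N) (a : n.-tuple int)
    (ha : rotundus a = 0) (hpos : totally_positive a) :
  exists D : {set {set 'I_(n + n)}},
    [/\ triangulation D,
        centrally_symmetric D
      & forall i : 'I_n,
          (triangles_at D (lshift n i))%:Z = tnth a i /\
          (triangles_at D (rshift n i))%:Z = tnth a i].
Proof.
pose A i := periodic_ext a (Posz i).
pose p k := recur A 1 0 k.+1; pose q k := recur A 0 1 k.+1.
exists (unit_diagonals (n + n) p q); split.
- exact: unit_diagonals_triangulation (rotundus_frieze hn ha hpos).
- exact: rotundus_symmetric.
(* The vertex opposite to [i] has index [n + i], where periodicity gives the same entry. *)
- move=> i; rewrite !rotundus_quiddity //= addnC periodic_ext_add.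
  by rewrite periodic_ext_ord.
Qed.
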